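(* Let $P$ and $Q$ be two polytopes in $\mathbb{R}^n$ such that the normal fan of $P$ refines the normal fan of $Q$. If $P$ is positively oriented by $\vec v\in\mathbb{R}^n$, then $Q$ is positively oriented by $\vec v$.
   Context: The normal cone of a nonempty face $F$ of a polytope $P\subset\mathbb{R}^n$ is $\mathcal{N}_P(F)=\{c\in\mathbb{R}^n: F\subseteq\{x\in P:\langle c,x\rangle=\max_{y\in P}\langle c,y\rangle\}\}$, and the normal fan of $P$ is the collection of all $\mathcal{N}_P(F)$ ($P$ need not be full-dimensional; the normal fan always covers $\mathbb{R}^n$). A fan $\mathcal{G}'$ refines a fan $\mathcal{G}$ if they have the same union and every cone of $\mathcal{G}$ is a union of cones of $\mathcal{G}'$. For $z\in P$ put $\rho_zP=2z-P$. The polytope $P$ is positively oriented by $\vec v$ if for every $z\in P$ the vector $\vec v$ is not perpendicular to any edge of the polytope $P\cap\rho_zP$. *)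

(* Defs.v *)
From mathcomp Require Import all_boot all_order all_algebra.
From mathcomp Require Import boolp classical_sets reals.

Set Implicit Arguments.
Unset Strict Implicit.
Unset Printing Implicit Defensive.

Import Order.TTheory GRing.Theory Num.Theory.

Local Open Scope classical_set_scope.
Local Open Scope ring_scope.

Definition dot (R : realType) (n : nat) (x y : 'rV[R]_n) : R :=
  \sum_(i < n) x ord0 i * y ord0 i.

Definition conv_hull (R : realType) (n m : nat) (a : 'I_m -> 'rV[R]_n) :
    set 'rV[R]_n :=
  [set x | exists w : 'I_m -> R,
     [/\ forall i, 0 <= w i, \sum_(i < m) w i = 1
       & x = \sum_(i < m) w i *: a i]].

(* The empty set is a polytope (m = 0). *)
Definition is_polytope (R : realType) (n : nat) (P : set 'rV[R]_n) : Prop :=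
  exists (m : nat) (a : 'I_m -> 'rV[R]_n), P = conv_hull a.

(* A face is the locus of equality of a valid linear inequality. This makes
   P (c = 0, b = 0) and the empty set (c = 0, b = 1) faces of P. *)
Definition is_face (R : realType) (n : nat) (P F : set 'rV[R]_n) : Prop :=
  exists (c : 'rV[R]_n) (b : R),
    (forall x, P x -> dot c x <= b) /\ F = [set x | P x /\ dot c x = b].

Definition max_locus (R : realType) (n : nat) (P : set 'rV[R]_n)
    (c : 'rV[R]_n) : set 'rV[R]_n :=
  [set x | P x /\ forall y, P y -> dot c y <= dot c x].

Definition normal_cone (R : realType) (n : nat) (P F : set 'rV[R]_n) :
    set 'rV[R]_n :=
  [set c | F `<=` max_locus P c].

Definition normal_fan (R : realType) (n : nat) (P : set 'rV[R]_n) :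
    set (set 'rV[R]_n) :=
  [set C | exists F, [/\ is_face P F, F !=set0 & C = normal_cone P F]].

Definition refines (T : Type) (G' G : set (set T)) : Prop :=
  \bigcup_(C in G') C = \bigcup_(C in G) C /\
  forall C, G C -> exists2 S, S `<=` G' & C = \bigcup_(D in S) D.

(* U is the linear span of the differences of points of A, i.e. the
   direction of the affine hull of A when A is nonempty. *)
Definition is_direction (R : realType) (n : nat) (A : set 'rV[R]_n)
    (U : {vspace 'rV[R]_n}) : Prop :=
  (forall x y, A x -> A y -> x - y \in U) /\
  (forall W : {vspace 'rV[R]_n},
     (forall x y, A x -> A y -> x - y \in W) -> (U <= W)%VS).

Definition has_dim (R : realType) (n : nat) (A : set 'rV[R]_n) (d : nat) :
    Prop :=
  A !=set0 /\ exists2 U : {vspace 'rV[R]_n}, is_direction A U & \dim U = d.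

Definition is_edge (R : realType) (n : nat) (P E : set 'rV[R]_n) : Prop :=
  is_face P E /\ has_dim E 1%N.

Definition perpendicular (R : realType) (n : nat) (v : 'rV[R]_n)
    (A : set 'rV[R]_n) : Prop :=
  forall x y, A x -> A y -> dot v (x - y) = 0.

Definition rho (R : realType) (n : nat) (z : 'rV[R]_n) (P : set 'rV[R]_n) :
    set 'rV[R]_n :=
  [set 2 *: z - x | x in P].

Definition positively_oriented (R : realType) (n : nat) (P : set 'rV[R]_n)
    (v : 'rV[R]_n) : Prop :=
  forall z, P z -> forall E, is_edge (P `&` rho z P) E -> ~ perpendicular v E.

(* Main.v *)
(* The edge directions of the polytopes [P `&` rho z P], over all [z] in [P], are
   the lines of the form lin F `&` lin G with F, G faces of [P]. If the normal
   fan of [P] refines that of [Q], every face of [Q] is parallel to a face of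
   [P], because a generic vector of the normal cone of the former lies in a cone
   of the normal fan of [P] with the same span. So every edge direction for [Q]
   is one for [P]. Faces of [Q] enter only through the vectors normal to [Q] at a
   point [x]: their orthogonal complement is the direction of the minimal face
   through [x]. *)
Require Import Defs.
From mathcomp Require Import all_boot all_order all_algebra.
From mathcomp Require Import boolp classical_sets reals.
From mathcomp Require Import ring lra.

Import Order.TTheory GRing.Theory Num.Theory.
Local Open Scope classical_set_scope.
Local Open Scope ring_scope.

(** * Inner product and the Farkas alternative *)

Lemma dotC {R : realType} {n : nat} (x y : 'rV[R]_n) : dot x y = dot y x.
Proof. by apply: eq_bigr => i _; rewrite mulrC. Qed.

Lemma dotDr {R : realType} {n : nat} (w x y : 'rV[R]_n) :
  dot w (x + y) = dot w x + dot w y.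
Proof. by rewrite -big_split; apply: eq_bigr => i _; rewrite mxE mulrDr. Qed.

Lemma dotZr {R : realType} {n : nat} (w : 'rV[R]_n) (k : R) (x : 'rV[R]_n) :
  dot w (k *: x) = k * dot w x.
Proof. by rewrite mulr_sumr; apply: eq_bigr => i _; rewrite mxE mulrCA. Qed.

Lemma dotNr {R : realType} {n : nat} (w x : 'rV[R]_n) : dot w (- x) = - dot w x.
Proof. by rewrite -scaleN1r dotZr mulN1r. Qed.

Lemma dotBr {R : realType} {n : nat} (w x y : 'rV[R]_n) :
  dot w (x - y) = dot w x - dot w y.
Proof. by rewrite dotDr dotNr. Qed.

Lemma dot0r {R : realType} {n : nat} (w : 'rV[R]_n) : dot w 0 = 0.
Proof. by rewrite -(scale0r 0) dotZr mul0r. Qed.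

Lemma dotDl {R : realType} {n : nat} (x y w : 'rV[R]_n) :
  dot (x + y) w = dot x w + dot y w.
Proof. by rewrite dotC dotDr !(dotC w). Qed.

Lemma dotZl {R : realType} {n : nat} (k : R) (x w : 'rV[R]_n) :
  dot (k *: x) w = k * dot x w.
Proof. by rewrite dotC dotZr (dotC w). Qed.

Lemma dotBl {R : realType} {n : nat} (x y w : 'rV[R]_n) :
  dot (x - y) w = dot x w - dot y w.
Proof. by rewrite dotC dotBr !(dotC w). Qed.

Lemma dot_sumr {R : realType} {n m : nat} (w : 'rV[R]_n) (k : 'I_m -> R)
    (a : 'I_m -> 'rV[R]_n) :
  dot w (\sum_i k i *: a i) = \sum_i k i * dot w (a i).
Proof.
rewrite (big_morph (dot w) (dotDr w) (dot0r w)).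
by apply: eq_bigr => i _; rewrite dotZr.
Qed.

Lemma dot_gt0 {R : realType} {n : nat} (x : 'rV[R]_n) : x != 0 -> 0 < dot x x.
Proof.
move=> x0; rewrite lt_def sumr_ge0 ?andbT; last first.
  by move=> i _; rewrite -expr2 sqr_ge0.
apply: contra x0; rewrite psumr_eq0; last by move=> i _; rewrite -expr2 sqr_ge0.
move=> /allP x0; apply/eqP/rowP => i; rewrite mxE; apply/eqP.
by have := x0 i; rewrite mem_index_enum mulf_eq0 orbb; apply.
Qed.

(* Bartl's induction: when a certificate [c] for the last generators fails on
   the first generator [g ord0], everything is projected along [g ord0] onto
   the hyperplane orthogonal to [c]. *)
Lemma farkas {R : realType} {n m : nat} (g : 'I_m -> 'rV[R]_n) (b : 'rV[R]_n) :
  (exists2 k : 'I_m -> R, forall i, 0 <= k i & b = \sum_i k i *: g i) \/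
  (exists2 c, forall i, dot c (g i) <= 0 & 0 < dot c b).
Proof.
elim: m g b => [|m IHm] g b.
  have [->|/dot_gt0 b0] := eqVneq b 0.
    by left; exists (fun=> 0) => //; rewrite big_ord0.
  by right; exists b => // -[].
pose g' i := g (lift ord0 i).
have extend (k0 : R) (k : 'I_m -> R) : 0 <= k0 -> (forall i, 0 <= k i) ->
    b = k0 *: g ord0 + \sum_i k i *: g' i ->
    exists2 k : 'I_m.+1 -> R, forall i, 0 <= k i & b = \sum_i k i *: g i.
  move=> k00 k_ge0 ->.
  exists (fun i => if unlift ord0 i is Some j then k j else k0).
    by move=> i; case: unliftP.
  rewrite big_ord_recl unlift_none; congr (_ + _).
  by apply: eq_bigr => i _; rewrite liftK.
have [[k k0 bE]|[c cg cb]] := IHm g' b.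
  by left; apply: (extend 0 k) => //; rewrite scale0r add0r.
have [cg0|cg0] := leP (dot c (g ord0)) 0.
  by right; exists c => // i; have [j ->|->] := unliftP ord0 i; first exact: cg.
have cg0N : dot c (g ord0) != 0 by rewrite gt_eqF.
pose pr x := x - (dot c x / dot c (g ord0)) *: g ord0.
have [[k k0 bE]|[c' cg' cb']] := IHm (pr \o g') (pr b).
  (* Lift back along [g ord0]; its coefficient is nonnegative because [c] is positive on [b] and
     nonpositive on the [g' i]. *)
  left; pose r x := dot c x / dot c (g ord0).
  apply: (extend (r b - \sum_i k i * r (g' i)) k) => //.
    rewrite subr_ge0 (@le_trans _ _ 0) ?divr_ge0 ?(ltW cb) ?(ltW cg0) //.
    apply: sumr_le0 => i _; rewrite mulr_ge0_le0 //.
    by apply: mulr_le0_ge0; [exact: cg|rewrite invr_ge0 ltW].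
  transitivity (pr b + r b *: g ord0); first by rewrite subrK.
  rewrite bE scalerBl scaler_suml.
  under eq_bigr do rewrite /= /pr scalerBr scalerA.
  by rewrite sumrB addrAC [RHS]addrAC (addrC (r b *: _)).
(* The adjoint of [pr] applied to [c']; it kills [g ord0] because [pr] does. *)
pose c'' := c' - (dot c' (g ord0) / dot c (g ord0)) *: c.
have prE x : dot c'' x = dot c' (pr x).
  by rewrite dotBl dotZl /pr dotBr dotZr; ring.
right; exists c''; last by rewrite prE.
move=> i; rewrite prE; have [j ->|->] := unliftP ord0 i; first exact: cg'.
by rewrite /pr divff // scale1r subrr dot0r.
Qed.

(** * Polytopes and their exposed faces *)

Lemma conv_hull_gen {R : realType} {n m : nat} (a : 'I_m -> 'rV[R]_n) i :
  conv_hull a (a i).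
Proof.
exists (fun j => (j == i)%:R); split=> [j||]; first by rewrite ler0n.
  by rewrite (bigD1 i) //= eqxx big1 ?addr0 // => j /negbTE ->.
rewrite (bigD1 i) //= eqxx scale1r big1 ?addr0 // => j /negbTE ->.
by rewrite scale0r.
Qed.

Lemma polytope_convex {R : realType} {n : nat} (P : set 'rV[R]_n) x u (e t : R) :
  is_polytope P -> P x -> P (x + e *: u) -> 0 < e -> 0 <= t <= e ->
  P (x + t *: u).
Proof.
move=> [m [a ->]] [k [k0 k1 ->]] [l [l0 l1 lE]] e0 /andP[t0 te].
pose r := t / e.
have r0 : 0 <= r by rewrite divr_ge0 // ltW.
have r1 : 0 <= 1 - r by rewrite subr_ge0 ler_pdivrMr // mul1r.
have rE : r * e = t by rewrite divfK // gt_eqF.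
exists (fun i => (1 - r) * k i + r * l i); split=> [i||].
- by apply: addr_ge0; apply: mulr_ge0.
- by rewrite big_split /= -!mulr_sumr k1 l1 !mulr1 subrK.
clearbody r; under [RHS]eq_bigr do rewrite scalerDl -!scalerA.
rewrite big_split -!scaler_sumr -lE scalerDr scalerA rE /=.
by rewrite addrA -scalerDl subrK scale1r.
Qed.

Lemma polytope_midpoint {R : realType} {n : nat} (P : set 'rV[R]_n) x y :
  is_polytope P -> P x -> P y -> P (2^-1 *: (x + y)).
Proof.
move=> polyP Px Py.
have -> : 2^-1 *: (x + y) = x + 2^-1 *: (y - x).
  by apply/rowP => i; rewrite !mxE; field.
apply: (polytope_convex _ _ _ 1) => //; last by lra.
by rewrite scale1r addrC subrK.
Qed.

(** A weighted mean of numbers bounded by M equals M exactly when every term of nonzero weight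
    does. *)
Lemma max_locus_comb {R : realType} {n m : nat} (a : 'I_m -> 'rV[R]_n)
    (k : 'I_m -> R) w :
  (forall i, 0 <= k i) -> \sum_i k i = 1 ->
  max_locus (conv_hull a) w (\sum_i k i *: a i) <->
  forall i, k i != 0 -> max_locus (conv_hull a) w (a i).
Proof.
move=> k0 k1; set p := \sum_i _; have Pp : conv_hull a p by exists k.
split=> [[_ pmax] i ki|amax].
  have k_ge0 j : 0 <= k j * (dot w p - dot w (a j)).
    by rewrite mulr_ge0 // subr_ge0; apply/pmax/conv_hull_gen.
  have /psumr_eq0P : \sum_j k j * (dot w p - dot w (a j)) = 0.
    under eq_bigr do rewrite mulrBr.
    by rewrite sumrB -mulr_suml k1 mul1r -dot_sumr subrr.
  move=> /(_ (fun j _ => k_ge0 j) i isT) /eqP.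
  rewrite mulf_eq0 (negbTE ki) subr_eq0 /= => /eqP wE.
  by split=> [|y Py]; [exact: conv_hull_gen|rewrite -wE; apply: pmax].
split=> // y Py; rewrite dot_sumr -[leLHS]mul1r -k1 mulr_suml.
apply: ler_sum => i _; have [->|/amax[_ aimax]] := eqVneq (k i) 0.
  by rewrite !mul0r.
by rewrite ler_wpM2l // aimax.
Qed.

Lemma max_locus_eq {R : realType} {n : nat} {P : set 'rV[R]_n} {w x y} :
  max_locus P w x -> max_locus P w y -> dot w x = dot w y.
Proof. by move=> [Px xm] [Py ym]; apply/le_anti; rewrite xm // ym. Qed.

Lemma max_locus_sub {R : realType} {n : nat} {P : set 'rV[R]_n} {w x y} :
  max_locus P w x -> P y -> dot w y = dot w x -> max_locus P w y.
Proof. by move=> [Px xm] Py yx; split=> // s; rewrite yx; exact: xm. Qed.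

Lemma max_locus_face {R : realType} {n : nat} (P : set 'rV[R]_n) w x :
  max_locus P w x -> is_face P (max_locus P w).
Proof.
move=> mx; exists w, (dot w x); split; first by case: mx.
apply/seteqP; split=> y /=; last by move=> [Py yx]; exact: max_locus_sub mx _ _.
by move=> my; split; [case: my|exact: max_locus_eq my mx].
Qed.

(* The barycenter of the generators lying on the face. *)
Lemma relative_interior_point {R : realType} {n : nat} (P : set 'rV[R]_n) c :
  is_polytope P -> max_locus P c !=set0 ->
  exists2 p, max_locus P c p &
    forall w, max_locus P w p -> max_locus P c `<=` max_locus P w.
Proof.
move=> [m [a ->]] [x cx]; set F := max_locus _ c.
have gens y : F y -> exists k : 'I_m -> R, [/\ forall i, 0 <= k i,
    \sum_i k i = 1, y = \sum_i k i *: a i & forall i, k i != 0 -> F (a i)].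
  move=> Fy; have [[k [k0 k1 yE]] _] := Fy; exists k; split=> //.
  by apply/max_locus_comb => //; rewrite -yE.
pose I := [pred i | `[< F (a i) >]].
have [j Ij] : exists j, I j.
  have [k [_ k1 _ kF]] := gens x cx.
  have [j _ kj] : exists2 j, true & k j != 0.
    have [//|kall] := pselect (exists2 j, true & k j != 0).
    have : 1 = 0 :> R.
      rewrite -k1 big1 // => j _; apply/eqP; apply: contra_notT kall => kj.
      by exists j.
    by move/eqP; rewrite oner_eq0.
  by exists j; apply/asboolP/kF.
have card_gt0 : (0 < #|I|)%N by apply/card_gt0P; exists j.
pose mu i : R := if I i then #|I|%:R^-1 else 0.
have mu0 i : 0 <= mu i by rewrite /mu; case: ifP; rewrite // invr_ge0 ler0n.
have mu1 : \sum_i mu i = 1.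
  rewrite -big_mkcond sumr_const -[_^-1 *+ _]mulr_natr mulVf //.
  by rewrite pnatr_eq0 -lt0n.
have muI i : (mu i != 0) = I i.
  rewrite /mu; case: ifP => _; last by rewrite eqxx.
  by rewrite invr_eq0 pnatr_eq0 -lt0n.
exists (\sum_i mu i *: a i).
  by apply/max_locus_comb => // i; rewrite muI => /asboolP.
(* Every generator on the face has positive weight in the barycenter, so [w] is maximal at each of
   them, hence on the face. *)
move=> w /max_locus_comb-/(_ mu0 mu1) wI y /gens[k [k0 k1 -> kF]].
apply/max_locus_comb => // i /kF Fi; apply: wI.
by rewrite muI; apply/asboolP.
Qed.

(** The face is the hull of the generators on it. These share one [c]-value, hence by hypothesis one
    [w]-value. *)
Lemma max_locus_const {R : realType} {n m : nat} (a : 'I_m -> 'rV[R]_n) c w :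
  (forall i j, dot c (a i - a j) = 0 -> dot w (a i - a j) = 0) ->
  forall x y, max_locus (conv_hull a) c x -> max_locus (conv_hull a) c y ->
  dot w (x - y) = 0.
Proof.
move=> cw; set F := max_locus _ c => x y Fx Fy.
have half s i : F s -> F (a i) -> dot w s = dot w (a i).
  move=> Fs Fi; have [[k [k0 k1 sE]] _] := Fs.
  rewrite sE dot_sumr -[RHS]mul1r -k1 mulr_suml.
  apply: eq_bigr => j _; have [->|kj] := eqVneq (k j) 0; first by rewrite !mul0r.
  congr (_ * _); apply/eqP; rewrite -subr_eq0 -dotBr; apply/eqP/cw.
  have Fj : F (a j) by move: j kj; apply/max_locus_comb => //; rewrite -sE.
  by rewrite dotBr (max_locus_eq Fj Fi) subrr.
have [[k [k0 k1 xE]] _] := Fx.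
have Fk : forall i, k i != 0 -> F (a i) by apply/max_locus_comb => //; rewrite -xE.
rewrite dotBr xE dot_sumr -[dot w y]mul1r -k1 mulr_suml -sumrB big1 // => i _.
have [->|/Fk Fi] := eqVneq (k i) 0; first by rewrite !mul0r subrr.
by rewrite (half _ _ Fy Fi) subrr.
Qed.

(** * Feasible directions *)

(** Farkas for the cone generated by the [a i - x]: a combination giving [u] scales down to a step
    inside [P], and a separating vector is normal at [x]. *)
Lemma feasible_or_separated {R : realType} {n : nat} (P : set 'rV[R]_n) x u :
  is_polytope P -> P x ->
  (exists2 e, 0 < e & P (x + e *: u)) \/
  (exists2 w, max_locus P w x & 0 < dot w u).
Proof.
move=> [m [a ->]] [k [k0 k1 xE]].
have [[l l0 uE]|[w wa wu]] := farkas (fun i => a i - x) u; last first.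
  right; exists w => //; split; first by exists k.
  move=> y [l [l0 l1 ->]]; rewrite dot_sumr -[leRHS]mul1r -l1 mulr_suml.
  by apply: ler_sum => i _; rewrite ler_wpM2l // -subr_le0 -dotBr.
left; pose L := \sum_i l i; have L0 : 0 <= L by rewrite sumr_ge0.
have e0 : 0 < (1 + L)^-1 by rewrite invr_gt0 ltr_pwDl.
(* For this [e], [1 - e * L = e], so [x + e *: u] is a combination with weights
   [e * (k i + l i)]. *)
exists (1 + L)^-1 => //; pose e := (1 + L)^-1; rewrite -/e in e0 *.
have eL : e * L = 1 - e by rewrite /e; field; rewrite gt_eqF // ltr_pwDl.
have uE' : u = \sum_i l i *: a i - L *: x.
  rewrite uE; under eq_bigr do rewrite scalerBr.
  by rewrite sumrB -scaler_suml.
exists (fun i => e * k i + e * l i); split=> [i||].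
- by rewrite addr_ge0 ?mulr_ge0 // ltW.
- by rewrite big_split /= -!mulr_sumr k1 mulr1 eL addrC subrK.
under eq_bigr do rewrite scalerDl -!scalerA.
rewrite big_split -!scaler_sumr -xE uE' scalerBr scalerA eL /=.
by apply/rowP => i; rewrite !mxE; ring.
Qed.

(** No normal at [x] separates [u] and none at [y] separates [- u]; convexity allows the smaller of
    the two steps. *)
Lemma opposite_feasible {R : realType} {n : nat} (P : set 'rV[R]_n) x y u :
  is_polytope P -> P x -> P y ->
  (forall w, max_locus P w x -> dot w u = 0) ->
  (forall w, max_locus P w y -> dot w u = 0) ->
  exists2 e, 0 < e & P (x + e *: u) /\ P (y - e *: u).
Proof.
move=> polyP Px Py ux uy.
have [[e e0 Pe]|[w /ux ->]] := feasible_or_separated P x u polyP Px; last first.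
  by rewrite ltxx.
have [[f f0 Pf]|[w /uy wu]] := feasible_or_separated P y (- u) polyP Py; last first.
  by rewrite dotNr wu oppr0 ltxx.
exists (Num.min e f); first by rewrite lt_min e0 f0.
have m0 : 0 <= Num.min e f by rewrite le_min !ltW.
rewrite -scalerN; split.
  by apply: polytope_convex Pe _ _ => //; rewrite m0 ge_min lexx.
by apply: polytope_convex Pf _ _ => //; rewrite m0 ge_min lexx orbT.
Qed.

(** * Generic normals and parallel faces *)

(** Induction on [D]: if some [w] in [N] is not orthogonal to [d], adding a large multiple of it to
    [c] makes [c] generic for [d] and creates no new orthogonality. *)
Lemma generic_vector {R : realType} {n : nat} (N : set 'rV[R]_n)
    (D : seq 'rV[R]_n) :
  N !=set0 -> (forall c w t, N c -> N w -> 0 < t -> N (c + t *: w)) ->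
  exists2 c, N c &
    forall d, d \in D -> dot c d = 0 -> forall w, N w -> dot w d = 0.
Proof.
move=> [c0 Nc0] Ncone; elim: D => [|d D [c Nc cD]]; first by exists c0.
have [dN|dN] := pselect (forall w, N w -> dot w d = 0).
  exists c => // d'; rewrite inE => /orP[/eqP -> //|]; exact: cD.
have [w Nw wd] : exists2 w, N w & dot w d <> 0.
  by apply/not_exists2P => dN'; apply: dN => w Nw; have [|/contrapT] := dN' w.
pose r d' := `|dot c d' / dot w d'|.
(* Larger than every ratio, so the two terms of [dot (c + t *: w) d'] cancel only if both vanish. *)
pose t := 1 + \sum_(d' <- d :: D) r d'.
have r_ge0 d' : 0 <= r d' by exact: normr_ge0.
have t_gt d' : d' \in d :: D -> r d' < t.
  move=> d'D; rewrite /t (big_rem _ d'D) /=.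
  have : 0 <= \sum_(y <- rem d' (d :: D)) r y by rewrite sumr_ge0.
  lra.
have t0 : 0 < t by rewrite (le_lt_trans (r_ge0 d)) // t_gt // mem_head.
have avoid d' : d' \in d :: D -> dot (c + t *: w) d' = 0 ->
    dot c d' = 0 /\ dot w d' = 0.
  move=> /t_gt d't; rewrite dotDl dotZl.
  have [->|wd'] := eqVneq (dot w d') 0; first by rewrite mulr0 addr0.
  move=> /eqP; rewrite addr_eq0 => /eqP cE.
  by move: d't; rewrite /r cE mulNr mulfK // normrN gtr0_norm // ltxx.
exists (c + t *: w); first exact: Ncone.
move=> d' d'D /(avoid _ d'D)[cd' wd']; move: d'D.
rewrite inE => /orP[/eqP dE|d'D]; first by rewrite dE in wd'.
exact: cD.
Qed.

(* The face of [P] exposed by a generic [c] in the normal cone of [Q] at [x]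
   is parallel to the minimal face of [Q] through [x]. *)
Lemma parallel_face {R : realType} {n : nat} (P Q : set 'rV[R]_n) x :
  is_polytope P -> refines (normal_fan P) (normal_fan Q) -> Q x ->
  exists c p, [/\ max_locus Q c x, max_locus P c p,
    forall w, max_locus P w p -> max_locus Q w x &
    forall w, max_locus Q w x -> forall s t, max_locus P c s ->
      max_locus P c t -> dot w (s - t) = 0].
Proof.
move=> polyP [_ refPQ] Qx; have [m [a PE]] := polyP.
pose D := [seq a i - a j | i <- enum 'I_m, j <- enum 'I_m].
have [||c cx cD] := generic_vector [set w | max_locus Q w x] D.
- by exists 0; split=> // y _; rewrite !(dotC 0) !dot0r.
- move=> c w t [_ cx] [_ wx] t0; split=> // y Qy.
  by rewrite !dotDl !dotZl lerD ?cx // ler_pM2l ?wx.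
have [S SP QE] : exists2 S, S `<=` normal_fan P &
    normal_cone Q (max_locus Q c) = \bigcup_(C in S) C.
  apply: refPQ; exists (max_locus Q c); split=> //; last by exists x.
  exact: max_locus_face cx.
(* Refinement puts [c] in the cone [C] of a face [G] of [P], and [C] lies in the normal cone of the
   face of [Q] exposed by [c]. *)
have [C SC Cc] : (\bigcup_(C in S) C) c by rewrite -QE.
have [G [_ [s Gs] CE]] := SP _ SC.
have GF : G `<=` max_locus P c by rewrite CE in Cc.
have [p Fp pF] := relative_interior_point P c polyP (ex_intro _ s (GF _ Gs)).
exists c, p; split=> // w => [wp|wx].
  (* By the choice of [p], [w] is maximal on [max_locus P c], hence on [G], so it lies in [C]. *)
  have : normal_cone Q (max_locus Q c) w.
    rewrite QE; exists C => //; rewrite CE.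
    by move=> g /GF; apply: pF.
  exact.
rewrite PE; apply: max_locus_const => i j cij; apply: cD wx => //.
by apply/allpairsP; exists (i, j); rewrite !mem_enum.
Qed.

(** * Point reflections and one-dimensional sets *)

Lemma rhoE {R : realType} {n : nat} (z : 'rV[R]_n) P s :
  rho z P s <-> P (2 *: z - s).
Proof.
split=> [[x Px <-]|Ps]; first by rewrite opprB addrC subrK.
by exists (2 *: z - s) => //; rewrite opprB addrC subrK.
Qed.

Lemma has_dim1 {R : realType} {n : nat} (A : set 'rV[R]_n) x d (e : R) :
  A x -> A (x + e *: d) -> e *: d != 0 ->
  (forall s t, A s -> A t -> s - t \in <[d]>%VS) -> has_dim A 1.
Proof.
move=> Ax Ay ed0 Ad; split; first by exists x.
have [e0 d0] : e != 0 /\ d != 0.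
  by move: ed0; rewrite scaler_eq0 negb_or => /andP.
exists <[d]>%VS; last by rewrite dim_vline d0.
split=> // W AW; have := AW _ _ Ay Ax.
rewrite addrAC subrr add0r -memvE => /(memvZ e^-1).
by rewrite scalerA mulVf // scale1r.
Qed.

Lemma has_dim1_line {R : realType} {n : nat} (A : set 'rV[R]_n) :
  has_dim A 1 -> exists x y, [/\ A x, A y, x != y &
    forall s t, A s -> A t -> s - t \in <[y - x]>%VS].
Proof.
move=> [[x Ax] [U [UA Umin] dimU]].
have [y Ay yx] : exists2 y, A y & y != x.
  apply/not_exists2P => Ax1.
  have Ax1' s : A s -> s = x by move=> As; have [|/negP/negPn/eqP] := Ax1 s.
  have /dimvS : (U <= 0)%VS.
    by apply: Umin => s t /Ax1' -> /Ax1' ->; rewrite subrr mem0v.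
  by rewrite dimU dimv0.
exists x, y; split=> //; first by rewrite eq_sym.
suff -> : <[y - x]>%VS = U by exact: UA.
apply/eqP; rewrite eqEdim dimU dim_vline subr_eq0 yx leqnn andbT -memvE.
exact: UA.
Qed.

(** * Transfer of an edge from [Q] to [P] *)

Theorem corollary1p31 (R : realType) (n : nat) (P Q : set 'rV[R]_n)
    (v : 'rV[R]_n) (polyP : is_polytope P) (polyQ : is_polytope Q)
    (refPQ : refines (normal_fan P) (normal_fan Q))
    (posP : positively_oriented P v) :
  positively_oriented Q v.
Proof.
move=> z Qz E [[c [b [cb EE]]] /has_dim1_line[x0 [y0 [Ex0 Ey0 xy0 Eline]]]] vE.
set d := y0 - x0 in Eline.
have d0 : d != 0 by rewrite subr_eq0 eq_sym.
have vd : dot v d = 0 by exact: vE.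
(* A functional maximal over [Q] at the midpoint of a chord is constant along it, so normals at [x],
   or at its mirror image [y], are orthogonal to [d]. *)
pose x := 2^-1 *: (x0 + y0); pose y := 2 *: z - x.
have EP s : E s <-> [/\ Q s, Q (2 *: z - s) & dot c s = b].
  rewrite EE; split=> [[[Qs /rhoE Qs'] cs]//|[Qs Qs' cs]].
  by split=> //; split=> //; apply/rhoE.
have [Qx0 Qx0' cx0] := (EP _).1 Ex0; have [Qy0 Qy0' cy0] := (EP _).1 Ey0.
have Qx : Q x by exact: polytope_midpoint.
have yE : y = 2^-1 *: ((2 *: z - x0) + (2 *: z - y0)).
  by apply/rowP => i; rewrite !mxE; field.
have Qy : Q y by rewrite yE; exact: polytope_midpoint.
have cx : dot c x = b by rewrite dotZr dotDr cx0 cy0; field.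
have Ex : E x by apply/EP.
have x_d w : max_locus Q w x -> dot w d = 0.
  move=> [_ wx]; have := wx _ Qx0; have := wx _ Qy0.
  by rewrite dotZr dotDr dotBr; lra.
have y_d w : max_locus Q w y -> dot w d = 0.
  move=> [_ wy]; have := wy _ Qx0'; have := wy _ Qy0'.
  by rewrite yE /d !(dotZr, dotDr, dotNr); lra.
(* Such a [u] can be followed both ways from [x] inside [Q] and its reflection. As [c] is maximal at
   [x], it vanishes on [u], so [x + e *: u] stays in [E]. *)
have perp_line u : (forall w, max_locus Q w x -> dot w u = 0) ->
    (forall w, max_locus Q w y -> dot w u = 0) -> u \in <[d]>%VS.
  move=> ux uy; have c_le u' e : 0 < e -> Q (x + e *: u') ->
      Q (y - e *: u') -> dot c u' <= 0.
    move=> e0 Qe Qe'; have : dot c (x + e *: u') <= b.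
      by apply: cb; split=> //; apply/rhoE; rewrite opprD addrA.
    by rewrite dotDr cx dotZr gerDl pmulr_rle0.
  have [e e0 [Qe Qe']] := opposite_feasible Q x y u polyQ Qx Qy ux uy.
  have [||f f0 [Qf Qf']] := opposite_feasible Q x y (- u) polyQ Qx Qy.
  - by move=> w /ux; rewrite dotNr => ->; rewrite oppr0.
  - by move=> w /uy; rewrite dotNr => ->; rewrite oppr0.
  have cu : dot c u = 0.
    have := c_le _ _ e0 Qe Qe'; have := c_le _ _ f0 Qf Qf'.
    by rewrite dotNr; lra.
  have Ee : E (x + e *: u).
    by apply/EP; rewrite opprD addrA dotDr (dotZr c e) cu mulr0 addr0.
  have := Eline _ _ Ee Ex.
  rewrite addrAC subrr add0r => /(memvZ e^-1).
  by rewrite scalerA mulVf ?gt_eqF // scale1r.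
have [cx' [p [Qcx Pcp pN pline]]] := parallel_face P Q x polyP refPQ Qx.
have [cy' [q [Qcy Pcq qN qline]]] := parallel_face P Q y polyP refPQ Qy.
have [Pp pmax] := Pcp; have [Pq qmax] := Pcq.
(* The centre for which [rho z'] swaps [p] and [q]. *)
pose z' := 2^-1 *: (p + q).
have z'E : 2 *: z' = p + q by rewrite scalerA divff ?pnatr_eq0 // scale1r.
(* At [p], [cx'] is maximal over [P] and [- cy'] over [rho z' P]. So [E'] is the face exposed by
   [cx'] intersected with the reflection of the one exposed by [cy']. *)
pose E' := [set s | (P `&` rho z' P) s /\ dot (cx' - cy') s = dot (cx' - cy') p].
have E'P s : E' s -> max_locus P cx' s /\ max_locus P cy' (p + q - s).
  move=> [[Ps /rhoE]]; rewrite z'E !dotBl => Ps' cs.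
  have := pmax _ Ps; have := qmax _ Ps'; rewrite dotBr dotDr => qs ps.
  split; first by apply: max_locus_sub Pcp _ _ => //; lra.
  by apply: max_locus_sub Pcq _ _ => //; rewrite dotBr dotDr; lra.
have E'p : E' p.
  by split=> //; split=> //; apply/rhoE; rewrite z'E addrAC subrr add0r.
(* Normals to [P] at [p], [q] are normals to [Q] at [x], [y], hence orthogonal to [d]; so [E']
   contains a segment along [d]. *)
have [||e e0 [Pe Pe']] := opposite_feasible P p q d polyP Pp Pq.
- by move=> w /pN/x_d.
- by move=> w /qN/y_d.
(* A difference within [E'] is a direction of both faces of [P], hence orthogonal to all normals to
   [Q] at [x] and at [y]. *)
have E'line s t : E' s -> E' t -> s - t \in <[d]>%VS.
  move=> /E'P[sx sy] /E'P[tx ty]; apply: perp_line => w wm.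
    exact: pline.
  have := qline w wm _ _ ty sy.
  by rewrite !(dotBr, dotDr); lra.
apply: (posP z' _ E'); first exact: polytope_midpoint.
- split; last first.
    apply: (has_dim1 _ p d e) => //; last by rewrite scaler_eq0 negb_or d0 gt_eqF.
    split; last first.
      rewrite dotDr (dotZr _ e d) (dotBl _ _ d) (x_d _ Qcx) (y_d _ Qcy).
      by rewrite subrr mulr0 addr0.
    by split=> //; apply/rhoE; rewrite z'E opprD addrA (addrC p) addrK.
  exists (cx' - cy'), (dot (cx' - cy') p); split=> // s [Ps /rhoE].
  rewrite z'E !dotBl => Ps'; have := pmax _ Ps; have := qmax _ Ps'.
  by rewrite dotBr dotDr; lra.
- move=> s t E's E't; have /vlineP[k ->] := E'line _ _ E's E't.
  by rewrite dotZr vd mulr0.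
Qed.
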